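(* Let $(\Omega,\Sigma,\mu)$ be a finite measure space, let $Y_0(\mu)$ and $Y_1(\mu)$ be Banach function spaces over $\mu$ and let $(M,d)$ be a metric space. Consider a map $T:M\to Y_0(\mu)\cap Y_1(\mu)$ such that there are constants $K_0,K_1>0$ for which the maps $T_i:=I_i\circ T:M\to Y_i(\mu)$, $i=0,1$, satisfy the Lipschitz inequalities $$\|T_i(x)-T_i(y)\|_{Y_i(\mu)}\le K_i\,d(x,y),\quad x,y\in M.$$ Then, for each $\theta\in(0,1)$, the map $T_\theta:M\to Y_0^{1-\theta}Y_1^\theta$ given by $T_\theta:=I_\theta\circ T$ is well defined and satisfies $$\|T_\theta(x)-T_\theta(y)\|_{Y_0^{1-\theta}Y_1^\theta}\le K_0^{1-\theta}K_1^\theta\,d(x,y),\quad x,y\in M.$$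
   Context: $L^0(\mu)$ is the space of classes of $\mu$-a.e. equal measurable functions. A Banach function space $Y(\mu)$ is a linear ideal of $L^0(\mu)$ with a complete norm such that if $f\in L^0(\mu)$, $|f|\le g$ and $g\in Y(\mu)$ then $f\in Y(\mu)$ and $\|f\|_{Y(\mu)}\le\|g\|_{Y(\mu)}$, and which contains the characteristic functions of sets of finite measure. For $0\le\theta\le1$, the Calderón–Lozanovskii space $Y_0^{1-\theta}Y_1^\theta=Y_0(\mu)^{1-\theta}Y_1(\mu)^\theta$ is the set of all $x\in L^0(\mu)$ for which there are $x_0\in Y_0(\mu)$, $x_1\in Y_1(\mu)$ with $|x|\le|x_0|^{1-\theta}|x_1|^\theta$, with norm $$\|x\|_{Y_0^{1-\theta}Y_1^\theta}:=\inf\|x_0\|_{Y_0}^{1-\theta}\|x_1\|_{Y_1}^\theta,$$ the infimum taken over all such dominations. It is a Banach function space over $\mu$ containing $Y_0(\mu)\cap Y_1(\mu)$. $I_\theta:Y_0(\mu)\cap Y_1(\mu)\hookrightarrow Y_0^{1-\theta}Y_1^\theta$, $\theta\in[0,1]$, are the inclusion maps; $I_0,I_1$ are the inclusions into $Y_0(\mu)$, $Y_1(\mu)$. *)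

(* Defs.v *)
From HB Require Import structures.
From mathcomp Require Import all_boot all_order all_algebra.
From mathcomp Require Import generic_quotient.
From mathcomp Require Import all_classical all_reals all_analysis.
From mathcomp Require Import measurable_realfun.

Set Implicit Arguments.
Unset Strict Implicit.
Unset Printing Implicit Defensive.

Import Order.TTheory GRing.Theory Num.Theory.
Import numFieldNormedType.Exports.

Local Open Scope classical_set_scope.
Local Open Scope ring_scope.
Local Open Scope quotient_scope.


Section L0_lmodType.
Context d (T : measurableType d) (R : realType).
Variable mu : {measure set T -> \bar R}.

Local Notation L0 := {mfun_ mu, T >-> R}.
Implicit Types (f g h : L0) (u v : {mfun T >-> R}) (a b : R).

(* Equality in L0 is mu-a.e. equality; the coercion to functions picks a
   representative, so pointwise formulas only make sense mu-a.e. *)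
Definition L0_class u : L0 := \pi_L0 u.

Lemma L0_classE u : \forall w \ae mu, L0_class u w = u w.
Proof.
have /eqmodP/asboolP : repr (L0_class u) = u %[mod L0] by rewrite reprK.
by apply: filterS => w; exact.
Qed.

Lemma L0_eqP f g : (\forall w \ae mu, f w = g w) -> f = g.
Proof.
move=> fg; rewrite -[f]reprK -[g]reprK; apply/eqmodP/asboolP.
by apply: filterS fg => w fgw _.
Qed.

Definition L0_zero : L0 := L0_class 0.
Definition L0_opp f : L0 := L0_class (- (repr f : {mfun T >-> R})).
Definition L0_add f g : L0 :=
  L0_class ((repr f : {mfun T >-> R}) + (repr g : {mfun T >-> R})).
Definition L0_scale a f : L0 := L0_class (a *: (repr f : {mfun T >-> R})).

Lemma L0_zeroE : \forall w \ae mu, L0_zero w = 0.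
Proof. exact: L0_classE. Qed.

Lemma L0_oppE f : \forall w \ae mu, L0_opp f w = - f w.
Proof. exact: L0_classE. Qed.

Lemma L0_addE f g : \forall w \ae mu, L0_add f g w = f w + g w.
Proof. exact: L0_classE. Qed.

Lemma L0_scaleE a f : \forall w \ae mu, L0_scale a f w = a * f w.
Proof. exact: L0_classE. Qed.

Let addA : associative L0_add.
Proof.
move=> f g h; apply: L0_eqP.
apply: filterS (filterI (L0_addE f (L0_add g h))
    (filterI (L0_addE g h)
    (filterI (L0_addE (L0_add f g) h)
    (L0_addE f g)))) => w [-> [-> [-> ->]]].
by rewrite addrA.
Qed.

Let addC : commutative L0_add.
Proof.
move=> f g; apply: L0_eqP.
by apply: filterS (filterI (L0_addE f g)
    (L0_addE g f)) => w [-> ->]; rewrite addrC.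
Qed.

Let add0 : left_id L0_zero L0_add.
Proof.
move=> f; apply: L0_eqP.
by apply: filterS (filterI (L0_addE L0_zero f)
    (L0_zeroE)) => w [-> ->]; rewrite add0r.
Qed.

Let addN : left_inverse L0_zero L0_opp L0_add.
Proof.
move=> f; apply: L0_eqP.
by apply: filterS (filterI (L0_addE (L0_opp f) f)
    (filterI (L0_oppE f)
    (L0_zeroE))) => w [-> [-> ->]];
  rewrite addNr.
Qed.

HB.instance Definition _ := GRing.isZmodule.Build L0 addA addC add0 addN.

Let scaleA a b f : L0_scale a (L0_scale b f) = L0_scale (a * b) f.
Proof.
apply: L0_eqP.
apply: filterS (filterI (L0_scaleE a (L0_scale b f))
    (filterI (L0_scaleE b f)
    (L0_scaleE (a * b) f))) => w [-> [-> ->]].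
by rewrite mulrA.
Qed.

Let scale1 : left_id 1 L0_scale.
Proof.
move=> f; apply: L0_eqP.
by apply: filterS (L0_scaleE 1 f) => w ->; rewrite mul1r.
Qed.

Let scaleDr : right_distributive L0_scale +%R.
Proof.
move=> a f g; apply: L0_eqP.
apply: filterS (filterI (L0_scaleE a (f + g))
    (filterI (L0_addE f g)
    (filterI (L0_scaleE a f)
    (filterI (L0_scaleE a g)
    (L0_addE (L0_scale a f) (L0_scale a g)))))) => w [-> [-> [af [ag ->]]]].
by rewrite af ag mulrDr.
Qed.

Let scaleDl f : {morph L0_scale^~ f : a b / a + b}.
Proof.
move=> a b; apply: L0_eqP.
apply: filterS (filterI (L0_scaleE (a + b) f)
    (filterI (L0_scaleE a f)
    (filterI (L0_scaleE b f)
    (L0_addE (L0_scale a f) (L0_scale b f))))) => w [-> [af [bf ->]]].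
by rewrite af bf mulrDl.
Qed.

HB.instance Definition _ :=
  GRing.Zmodule_isLmodule.Build R L0 scaleA scale1 scaleDr scaleDl.

End L0_lmodType.

Section banach_function_space.
Context d (T : measurableType d) (R : realType).
Variable mu : {measure set T -> \bar R}.

Local Notation L0 := {mfun_ mu, T >-> R}.

(* The norm is total on L0, but it is only meaningful on the space itself:
   no axiom constrains it elsewhere. *)
Record banachFunctionSpace := BanachFunctionSpace {
  bfs_set : set L0 ;
  bfs_norm : L0 -> R ;
  bfs_mem0 : bfs_set 0 ;
  bfs_memD : forall f g, bfs_set f -> bfs_set g -> bfs_set (f + g) ;
  bfs_memZ : forall (a : R) f, bfs_set f -> bfs_set (a *: f) ;
  bfs_norm_ge0 : forall f, bfs_set f -> 0 <= bfs_norm f ;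
  bfs_norm_eq0 : forall f, bfs_set f -> bfs_norm f = 0 -> f = 0 ;
  bfs_normZ : forall (a : R) f, bfs_set f ->
    bfs_norm (a *: f) = `|a| * bfs_norm f ;
  bfs_normD : forall f g, bfs_set f -> bfs_set g ->
    bfs_norm (f + g) <= bfs_norm f + bfs_norm g ;
  bfs_complete : forall u : nat -> L0, (forall n, bfs_set (u n)) ->
    (forall e : R, 0 < e -> exists N : nat, forall m n : nat,
      (N <= m)%N -> (N <= n)%N -> bfs_norm (u m - u n) < e) ->
    exists2 l, bfs_set l & bfs_norm (u n - l) @[n --> \oo] --> (0 : R) ;
  bfs_ideal : forall f g : L0,
    (\forall w \ae mu, `|f w| <= g w) -> bfs_set g ->
    bfs_set f /\ bfs_norm f <= bfs_norm g ;
  bfs_indic : forall A (mA : measurable A), (mu A < +oo)%E ->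
    bfs_set (L0_class mu (indic_mfun A mA))
}.

Implicit Types (Y : banachFunctionSpace) (x : L0) (theta : R).

(* Calderon-Lozanovskii space. Here 0 `^ 0 = 1. *)
Definition cl_dominated theta x x0 (x1 : L0) : Prop :=
  \forall w \ae mu, `|x w| <= `|x0 w| `^ (1 - theta) * `|x1 w| `^ theta.

Definition cl_space Y0 Y1 theta : set L0 :=
  [set x | exists x0 x1,
    [/\ bfs_set Y0 x0, bfs_set Y1 x1 & cl_dominated theta x x0 x1]].

(* [inf] is 0 on the empty set, so the value is only meaningful for x in
   [cl_space Y0 Y1 theta]. *)
Definition cl_norm Y0 Y1 theta x : R :=
  inf [set r | exists x0 x1,
    [/\ bfs_set Y0 x0, bfs_set Y1 x1, cl_dominated theta x x0 x1 &
     r = bfs_norm Y0 x0 `^ (1 - theta) * bfs_norm Y1 x1 `^ theta]].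

End banach_function_space.

(* Main.v *)
Require Import Defs.
From HB Require Import structures.
From mathcomp Require Import all_boot all_order all_algebra.
From mathcomp Require Import all_classical all_reals all_analysis.

Set Implicit Arguments.
Unset Strict Implicit.
Unset Printing Implicit Defensive.

Import Order.TTheory GRing.Theory Num.Theory.
Import numFieldNormedType.Exports.

Local Open Scope classical_set_scope.
Local Open Scope ring_scope.

(** The result is the geometric-mean inequality for the Calderon-Lozanovskii
    norm: every [x] in the intersection of [Y0] and [Y1] satisfies
    [cl_norm x <= norm_Y0 x `^ (1 - theta) * norm_Y1 x `^ theta], because
    [|x| = |x| `^ (1 - theta) * |x| `^ theta] makes the pair [(x, x)] admissible
    in the infimum defining [cl_norm] ([cl_norm_le_geo]).  Applied to
    [T x - T y], which lies in the intersection, the two Lipschitz bounds enter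
    with weights [1 - theta] and [theta]; the weights add up to 1, so the two
    powers of the distance recombine to the distance itself. *)

(** Powers of the same base multiply by adding exponents; at [a = 0] this is
    still legitimate because the exponents add up to 1, which is nonzero. *)
Lemma powR_weights (R : realType) (a theta : R) : 0 <= a ->
  a `^ (1 - theta) * a `^ theta = a.
Proof.
move=> a0; rewrite -powRD; first by rewrite subrK powRr1.
by rewrite subrK oner_eq0.
Qed.

Section calderon_lozanovskii.
Context d (Omega : measurableType d) (R : realType).
Variable mu : {measure set Omega -> \bar R}.
Implicit Types (Y : banachFunctionSpace mu) (x : {mfun_ mu, Omega >-> R}).

Lemma bfs_memB Y x y : bfs_set Y x -> bfs_set Y y -> bfs_set Y (x - y).
Proof.
by move=> Yx Yy; rewrite -scaleN1r; apply: bfs_memD => //; exact: bfs_memZ.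
Qed.

Lemma cl_dominated_diag theta x : cl_dominated theta x x x.
Proof. by apply: aeW => w; rewrite powR_weights. Qed.

Lemma cl_space_cap Y0 Y1 theta x : (bfs_set Y0 `&` bfs_set Y1) x ->
  cl_space Y0 Y1 theta x.
Proof. by case=> Y0x Y1x; exists x, x; split=> //; exact: cl_dominated_diag. Qed.

(** The diagonal pair [(x, x)] is one of the competitors of the infimum. *)
Lemma cl_norm_le_geo Y0 Y1 theta x : (bfs_set Y0 `&` bfs_set Y1) x ->
  cl_norm Y0 Y1 theta x <=
    bfs_norm Y0 x `^ (1 - theta) * bfs_norm Y1 x `^ theta.
Proof.
case=> Y0x Y1x; apply: ge_inf.
  by exists 0 => _ [x0 [x1 [_ _ _ ->]]]; rewrite mulr_ge0 ?powR_ge0.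
by exists x, x; split=> //; exact: cl_dominated_diag.
Qed.

End calderon_lozanovskii.

Theorem proposition5p1 (R : realType) (d : measure_display)
    (Omega : measurableType d) (mu : {finite_measure set Omega -> \bar R})
    (Y0 Y1 : banachFunctionSpace mu) (M : metricType R)
    (T : M -> {mfun_ mu, Omega >-> R})
    (T_cap : forall x, (bfs_set Y0 `&` bfs_set Y1) (T x))
    (K0 K1 : R) (K0_gt0 : 0 < K0) (K1_gt0 : 0 < K1)
    (T0_lip : forall x y, bfs_norm Y0 (T x - T y) <= K0 * mdist x y)
    (T1_lip : forall x y, bfs_norm Y1 (T x - T y) <= K1 * mdist x y)
    (theta : R) (theta01 : 0 < theta < 1) :
  (forall x, cl_space Y0 Y1 theta (T x)) /\
  (forall x y, cl_norm Y0 Y1 theta (T x - T y) <=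
     K0 `^ (1 - theta) * K1 `^ theta * mdist x y).
Proof.
have [theta_gt0 theta_lt1] := andP theta01.
split=> [x|x y]; first exact: cl_space_cap.
have TB : (bfs_set Y0 `&` bfs_set Y1) (T x - T y).
  by have [[? ?] [? ?]] := (T_cap x, T_cap y); split; exact: bfs_memB.
have [TB0 TB1] := TB.
apply: le_trans (cl_norm_le_geo theta TB) _.
have dxy_ge0 : 0 <= mdist x y by exact: mdist_ge0.
rewrite -[X in _ <= _ * X](powR_weights theta dxy_ge0) mulrACA.
rewrite -!powRM ?(ltW K0_gt0) ?(ltW K1_gt0)//.
by apply: ler_pM; rewrite ?powR_ge0// ge0_ler_powR// ?nnegrE ?bfs_norm_ge0//
  ?mulr_ge0 ?subr_ge0// ltW.
Qed.
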